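(* Let $G_k$ be the graph obtained from the crown graph $H_{k,k}$ by adding a universal vertex, i.e. a new vertex adjacent to all vertices of $H_{k,k}$. Then $G_k$ has representation number $k=\lfloor n/2\rfloor$, where $n$ is the number of vertices of $G_k$.
   Context: The crown graph $H_{k,k}$ is the graph obtained from the complete bipartite graph $K_{k,k}$ by removing a perfect matching. Two distinct letters $x,y$ alternate in a word $W$ if the word obtained from $W$ by deleting all letters other than $x$ and $y$ contains neither $xx$ nor $yy$ as a factor (two consecutive letters). A word $W$ represents a graph $G=(V,E)$ if, after identifying letters with vertices, the set of letters occurring in $W$ is $V$ (every vertex occurs at least once) and, for all distinct $x,y\in V$, $xy\in E$ if and only if $x$ and $y$ alternate in $W$. $G$ is word-representable if some word represents it. A word is $m$-uniform if each of its letters occurs in it exactly $m$ times. $G$ is $m$-word-representable if some $m$-uniform word represents it. The representation number of a word-representable graph $G$ is the minimum $m$ such that $G$ is $m$-word-representable.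
   Formalization: The claim is proved for k ≥ 2; it fails for k = 1, where G_1 is the path on three vertices with representation number 2, and for k = 0, where G_0 is a single vertex with representation number 1. *)

(* Defs.v *)
From HB Require Import structures.
From mathcomp Require Import all_boot.

Set Implicit Arguments.
Unset Strict Implicit.
Unset Printing Implicit Defensive.

Record sgraph := SGraph {
  vertex :> finType;
  edge : rel vertex;
  edge_sym : symmetric edge;
  edge_irrefl : irreflexive edge }.

Section Words.
Variable T : eqType.

Definition alternate (x y : T) (w : seq T) : bool :=
  let u := [seq z <- w | (z == x) || (z == y)] in
  ~~ infix [:: x; x] u && ~~ infix [:: y; y] u.

Definition uniform (m : nat) (w : seq T) : Prop :=
  forall x, x \in w -> count_mem x w = m.

End Words.

(* Letters are the vertices themselves, so [w] automatically uses no letter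
   outside of [G]. *)
Definition represents (G : sgraph) (w : seq G) : Prop :=
  (forall x : G, x \in w) /\
  (forall x y : G, x != y -> (edge x y <-> alternate x y w)).

Definition word_representable (G : sgraph) : Prop :=
  exists w : seq G, represents w.

Definition uniformly_representable (m : nat) (G : sgraph) : Prop :=
  exists w : seq G, uniform m w /\ represents w.

Definition has_representation_number (G : sgraph) (m : nat) : Prop :=
  [/\ word_representable G,
      uniformly_representable m G
    & forall m', uniformly_representable m' G -> m <= m'].

Section Crown.
Variable k : nat.
Implicit Types x y : 'I_k + 'I_k.

Definition complete_bipartite_rel : rel ('I_k + 'I_k) := fun x y =>
  match x, y with
  | inl _, inr _ | inr _, inl _ => true
  | _, _ => false
  end.

(* The choice of perfect matching of K_{k,k} is immaterial up to isomorphism;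
   the removed one joins the two copies of each index. *)
Definition matching_rel : rel ('I_k + 'I_k) := fun x y =>
  match x, y with
  | inl i, inr j | inr i, inl j => i == j
  | _, _ => false
  end.

Definition crown_rel : rel ('I_k + 'I_k) := fun x y =>
  complete_bipartite_rel x y && ~~ matching_rel x y.

Lemma crown_sym : symmetric crown_rel.
Proof. by move=> [i|i] [j|j] //=; rewrite /crown_rel /= eq_sym. Qed.

Lemma crown_irrefl : irreflexive crown_rel.
Proof. by case. Qed.

Definition crown : sgraph := SGraph crown_sym crown_irrefl.

End Crown.

Section Universal.
Variable G : sgraph.

(* [None] is the new vertex. *)
Definition universal_rel : rel (option G) := fun x y =>
  match x, y with
  | Some u, Some v => edge u v
  | None, None => false
  | _, _ => true
  end.

Lemma universal_sym : symmetric universal_rel.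
Proof. by move=> [x|] [y|] //=; apply: edge_sym. Qed.

Lemma universal_irrefl : irreflexive universal_rel.
Proof. by case=> [x|] //=; apply: edge_irrefl. Qed.

Definition add_universal : sgraph := SGraph universal_sym universal_irrefl.

End Universal.

(* Main.v *)
Require Import Defs.
From mathcomp Require Import all_boot.
From mathcomp Require Import zify.

Set Implicit Arguments.
Unset Strict Implicit.
Unset Printing Implicit Defensive.

(** A letter [u] alternating with every other letter cuts a word into
    permutations.  Alternation in a uniform word is a cyclic property
    ([alternate_cycle]), so an [m]-uniform word representing a graph with a
    universal vertex [u] can be rotated to begin with [u]; each other letter
    then occurs exactly once between two successive occurrences of [u], and the
    word is a concatenation of [m] permutations of the vertices
    ([universal_permutations]).  In such a concatenation two letters alternate
    exactly when they come in the same order in every permutation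
    ([alternate_flatten]).  The graph is thus the comparability graph of an
    intersection of [m] linear orders, and the representation number of [G_k]
    is the dimension of the standard example on [a_1, ..., a_k, b_1, ..., b_k],
    where [a_i] is below [b_j] for [i != j].

    Lower bound.  The intersection order makes [a_i] and [b_j] comparable for
    [i != j], and nothing else in the crown.  Two comparabilities sharing an
    end in the crown must point the same way, since transitivity would
    otherwise create an edge inside a side of the bipartition
    ([forced_up], [forced_down]).  For [k >= 3] the crown is connected, so
    every [a_i] is below every [b_j] with [i != j], or every one is above
    ([crown_orientation]).  In the first case each [i] needs a permutation
    putting [b_i] before [a_i], and no permutation can serve two indices:
    [b_i < a_i < b_j < a_j < b_i] would be a cycle ([reversals_bound]).  Hence
    [m >= k].  For [k = 2] the crown is disconnected, but one permutation only
    represents a complete graph.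

    Upper bound.  The permutation number [t] lists the universal vertex, the
    [a_i] with [i != t], then [b_t], [a_t], and the [b_j] with [j != t].  These
    [k] permutations reverse each pair [a_t, b_t] once and both orders occur
    inside each side, while every [a_i] stays before every [b_j], [i != j]. *)

(** * Alternation as a path condition *)

Section Alternation.
Variable T : eqType.
Implicit Types (x y z u : T) (s w p : seq T).

Definition restrict x y s := [seq z <- s | (z == x) || (z == y)].

Definition distinct : rel T := fun x y => x != y.

Lemma restrict_letters x y s : all (pred2 x y) (restrict x y s).
Proof. exact: filter_all. Qed.

Lemma count_restrict x y s :
  (count_mem x (restrict x y s) = count_mem x s) *
  (count_mem y (restrict x y s) = count_mem y s).
Proof.
split; rewrite count_filter; apply: eq_count => z /=.
  by case: (z == x).
by case: (z == y); rewrite ?orbT.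
Qed.

Lemma sorted_distinct_two_letters x y s : all (pred2 x y) s ->
  ~~ infix [:: x; x] s && ~~ infix [:: y; y] s = sorted distinct s.
Proof.
elim: s => [|a s IH] // /andP[ha hs].
rewrite 2!infix_consl !negb_or andbACA (IH hs) /= {IH}.
case: s hs => [|b s] /=; first by rewrite !andbF.
case/andP=> hb _; rewrite !prefix0s !andbT; congr andb; rewrite /distinct.
case/orP: ha => /eqP->; case/orP: hb => /eqP->.
- by rewrite eqxx.
- by rewrite !eqxx /=; case: (eqVneq x y).
- by rewrite !eqxx /=; case: (eqVneq y x).
- by rewrite eqxx andbF.
Qed.

Lemma alternateE x y s : alternate x y s = sorted distinct (restrict x y s).
Proof. exact/sorted_distinct_two_letters/restrict_letters. Qed.

(** An alternating word on two letters is balanced, up to one more occurrence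
    of its first letter when that is also the last one. *)
Lemma count_alternating a b s : a != b -> all (pred2 a b) s ->
  path distinct a s ->
  count_mem a (a :: s) = count_mem b (a :: s) + (last a s == a).
Proof.
elim: s a b => [|c s IH] a b hab /=; first by rewrite eqxx (negbTE hab).
case/andP=> hc hs /andP[hac hp].
have ec : c = b.
  by case/orP: hc => /eqP // ec; rewrite ec /distinct eqxx in hac.
subst c; have hba : b != a by rewrite eq_sym.
have hs' : all (pred2 b a) s by apply: sub_all hs => z /=; rewrite orbC.
have := IH _ _ hba hs' hp; rewrite /= !eqxx (negbTE hab) (negbTE hba) /=.
have : pred2 a b (last b s).
  have: last b s \in b :: s by apply: mem_last.
  by rewrite inE => /orP[/eqP->|/(allP hs)] //=; rewrite eqxx orbT.
move=> /= /orP[] /eqP ->; rewrite !eqxx ?(negbTE hab) ?(negbTE hba); lia.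
Qed.

(** Balanced alternating words begin and end with different letters, so
    alternation does not see where a uniform word is cut open. *)
Lemma alternate_cycle x y s : x != y -> count_mem x s = count_mem y s ->
  alternate x y s = cycle distinct (restrict x y s).
Proof.
move=> hxy; rewrite alternateE.
have [<- <-] := count_restrict x y s.
move: (restrict_letters x y s); case: (restrict x y s) => [|a l] //.
rewrite [all _ _]/= => /andP[ha hl] hc /=.
rewrite rcons_path; case hp: (path distinct a l) => //=; symmetry.
apply/negP => /eqP hlast.
have hyx : y != x by rewrite eq_sym.
have hl' : all (pred2 y x) l by apply: sub_all hl => z /=; rewrite orbC.
case/orP: ha => /eqP ea; subst a.
  have := count_alternating hxy hl hp; rewrite hlast eqxx; lia.
have := count_alternating hyx hl' hp; rewrite hlast eqxx; lia.
Qed.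

Lemma alternate_rot x y n s : x != y -> count_mem x s = count_mem y s ->
  alternate x y (rot n s) = alternate x y s.
Proof.
have count_rot z : count_mem z (rot n s) = count_mem z s.
  by apply/permP; rewrite perm_rot.
move=> hxy hc; rewrite alternate_cycle ?count_rot // alternate_cycle //.
rewrite /restrict /rot filter_cat -[in RHS](cat_take_drop n s) filter_cat.
by rewrite -rot_size_cat rot_cycle.
Qed.

(** * Concatenations of permutations *)

Definition before x y : pred (seq T) := fun p => index x p < index y p.

Lemma before_trans y x z p : before x y p -> before y z p -> before x z p.
Proof. exact: ltn_trans. Qed.

Lemma beforeN x y p : x != y -> x \in p -> before y x p = ~~ before x y p.
Proof.
move=> hxy hx; rewrite /before -leqNgt ltn_neqAle.
case: eqP => // e; exfalso; move: hxy.
have hy : y \in p by rewrite -index_mem e index_mem.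
by rewrite -(nth_index x hx) -e nth_index ?eqxx.
Qed.

Lemma restrict_uniq x y p : x != y -> uniq p -> x \in p -> y \in p ->
  restrict x y p = if before x y p then [:: x; y] else [:: y; x].
Proof.
rewrite /restrict /before => hxy.
have only a b s : a \notin s -> b \in s -> uniq s ->
    [seq z <- s | (z == a) || (z == b)] = [:: b].
  move=> ha hb hs; rewrite -(filter_pred1_uniq hs hb).
  apply: eq_in_filter => z hz /=; case: eqP => //= ez.
  by rewrite -ez hz in ha.
elim: p => [|z p IH] //= /andP[hz hp]; rewrite !inE.
have [ezx|nzx] := eqVneq z x.
  subst z => _; rewrite eq_sym (negbTE hxy) /= => hy.
  by rewrite only.
have [ezy|nzy] := eqVneq z y.
  subst z => /= hx _.
  under eq_filter => z do rewrite orbC.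
  by rewrite only.
by rewrite /= ?(negbTE nzx) ?(negbTE nzy) /=; apply: IH.
Qed.

(** Blocks [x y] and [y x] can only follow a block of the same kind. *)
Lemma alternate_flatten x y (ps : seq (seq T)) : x != y ->
  (forall p, p \in ps -> [/\ uniq p, x \in p & y \in p]) ->
  alternate x y (flatten ps) = all (before x y) ps || all (before y x) ps.
Proof.
move=> hxy hps; rewrite alternateE /restrict filter_flatten.
pose block p := if before x y p then [:: x; y] else [:: y; x].
have -> : [seq restrict x y p | p <- ps] = map block ps.
  by apply/eq_in_map => p /hps[? ? ?]; apply: restrict_uniq.
have -> : all (before y x) ps = all (predC (before x y)) ps.
  by apply: eq_in_all => p /hps[_ ? _]; apply: beforeN.
have hyx : y != x by rewrite eq_sym.
have path_y qs : path distinct y (flatten (map block qs)) = all (before x y) qs.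
  elim: qs => //= q qs <-; rewrite /block; case: before => /=;
    by rewrite /distinct ?hxy ?hyx ?eqxx.
have path_x qs :
    path distinct x (flatten (map block qs)) = all (predC (before x y)) qs.
  elim: qs => //= q qs <-; rewrite /block; case: before => /=;
    by rewrite /distinct ?hxy ?hyx ?eqxx.
case: ps {hps} => //= p ps; rewrite -path_x -path_y /block.
by case: before => /=; rewrite /distinct ?hxy ?hyx ?orbF.
Qed.

End Alternation.

Section Blocks.
Variable T : finType.
Implicit Types (x y u : T) (s p : seq T) (ps : seq (seq T)).

Lemma count_permutation p x : perm_eq p (enum T) -> count_mem x p = 1.
Proof. by move/permP->; rewrite count_uniq_mem ?enum_uniq // mem_enum. Qed.

Lemma alternate_permutations x y ps : x != y ->
  (forall p, p \in ps -> perm_eq p (enum T)) ->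
  alternate x y (flatten ps) = all (before x y) ps || all (before y x) ps.
Proof.
move=> hxy hps; apply: alternate_flatten => // p /hps hp.
by rewrite (perm_uniq hp) enum_uniq !(perm_mem hp) !mem_enum.
Qed.

Lemma count_permutations x ps : (forall p, p \in ps -> perm_eq p (enum T)) ->
  count_mem x (flatten ps) = size ps.
Proof.
elim: ps => //= p ps IH hps; rewrite count_cat IH.
  by rewrite count_permutation // hps ?mem_head.
by move=> q hq; apply: hps; rewrite inE hq orbT.
Qed.

Lemma cut_before u s :
  exists p r, [/\ s = p ++ r, u \notin p & head u r = u].
Proof.
exists (take (index u s) s), (drop (index u s) s); rewrite cat_take_drop.
have [hu|hu] := boolP (u \in s).
  by rewrite in_take // ltnn drop_index.
split=> //; first by apply: contra hu; apply: mem_take.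
by rewrite memNindex // drop_size.
Qed.

(** Between two occurrences of [u] a letter alternating with [u] occurs exactly
    once; after the last [u] it occurs at most once, and balance makes this
    once.  The word must begin with [u]: otherwise some letters would occur
    before the first [u] and others after the last one. *)
Lemma permutation_blocks u s : head u s = u ->
  (forall x, x != u -> alternate u x s /\ count_mem x s = count_mem u s) ->
  exists ps, [/\ flatten ps = s, size ps = count_mem u s
               & forall p, p \in ps -> perm_eq p (enum T)].
Proof.
have [n] := ubnP (size s); elim: n s => // n IH [|z s] /=.
  by move=> _ _ _; exists [::].
rewrite ltnS => hsz ez; subst z => halt.
have [p [r [es hup hr]]] := cut_before u s; subst s.
have hcup : count_mem u p = 0 by apply/count_memPn.
have split_at x : x != u ->
    [/\ count_mem x p = 1, alternate u x r & count_mem x r = count_mem u r].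
  move=> hxu; have hux : u != x by rewrite eq_sym.
  have [] := halt x hxu; rewrite alternateE /restrict /= eqxx /=.
  rewrite filter_cat -!/(restrict u x _) cat_path => /andP[hp hpr].
  rewrite !count_cat (negbTE hux) hcup => hc.
  have := count_alternating hux (restrict_letters u x p) hp.
  rewrite /= eqxx (negbTE hux) !count_restrict hcup.
  case hlast: (last u (restrict u x p) == u) => /= hcp.
    (* No [x] after this [u]: the next letter can be neither [u] nor absent. *)
    move: hpr hc; rewrite (eqP hlast).
    case: r hr {hsz halt} => [|z r] /= ez; first by move=> _; lia.
    by subst z; rewrite eqxx /= /distinct eqxx.
  split; [lia | | lia].
  by rewrite alternateE; case: (restrict u x r) hpr => //= z r' /andP[].
have [||ps [eps hsize hps]] := IH r _ hr.
- by move: hsz; rewrite size_cat; lia.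
- by move=> x /split_at[].
exists ((u :: p) :: ps); split=> [||q].
- by rewrite /= eps.
- by rewrite /= hsize count_cat eqxx hcup.
rewrite inE => /predU1P[->|/hps //].
apply/allP => x _; rewrite /= (@count_permutation (enum T)) //.
by have [->|/split_at[-> _ _]] := eqVneq x u; rewrite ?hcup.
Qed.

End Blocks.

(** * Graphs with a universal vertex *)

Section Representation.
Variable G : sgraph.
Implicit Types (x y z : G) (ps : seq (seq G)).

Lemma universal_permutations (u : G) m (w : seq G) :
  (forall x, x != u -> edge u x) -> uniform m w -> represents w ->
  exists ps, [/\ size ps = m, forall p, p \in ps -> perm_eq p (enum G)
               & represents (flatten ps)].
Proof.
move=> hu hw [hall hedge].
have hcount x y : count_mem x w = count_mem y w by rewrite !hw.
have [i s es] := rot_to (hall u).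
have hrot z : count_mem z (rot i w) = count_mem z w.
  by apply/permP; rewrite perm_rot.
have [||ps [eps hsize hps]] := @permutation_blocks _ u (rot i w).
- by rewrite es.
- move=> x hxu; rewrite !hrot (hcount x u) alternate_rot 1?eq_sym //.
  by split=> //; apply/hedge; rewrite 1?eq_sym // hu.
exists ps; split=> //; first by rewrite hsize hrot hw.
rewrite eps; split=> [x|x y hxy]; first by rewrite mem_rot.
by rewrite alternate_rot //; apply: hedge.
Qed.

(** A weak order, given by a rank function, suffices to describe a permutation
    as long as only comparisons of distinct ranks matter. *)
Lemma ranks_represent m (r : 'I_m -> G -> nat) : 0 < m ->
  (forall x y, edge x y ->
     (forall t, r t x < r t y) \/ (forall t, r t y < r t x)) ->
  (forall x y, x != y -> ~~ edge x y -> exists t, r t x < r t y) ->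
  uniformly_representable m G.
Proof.
move=> hm hedge hnedge.
pose perm t := sort (relpre (r t) leq) (enum G).
pose ps := [seq perm t | t <- enum 'I_m].
have hps p : p \in ps -> perm_eq p (enum G).
  by case/mapP=> t _ ->; rewrite /perm perm_sort.
have hsize : size ps = m by rewrite size_map size_enum_ord.
have hcount x : count_mem x (flatten ps) = m by rewrite count_permutations.
have hrank t x y : r t x < r t y -> before x y (perm t).
  apply: contraTT; rewrite -!leqNgt => hle.
  have tr : transitive (relpre (r t) leq) by move=> ? ? ?; apply: leq_trans.
  have hin z : z \in perm t by rewrite mem_sort mem_enum.
  have rf : reflexive (relpre (r t) leq) by move=> ? /=.
  apply: (sorted_leq_index tr rf _ _ _ (hin y) (hin x) hle).
  by apply: sort_sorted => ? ?; apply: leq_total.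
have all_before x y : (forall t, r t x < r t y) -> all (before x y) ps.
  by move=> h; apply/allP => p /mapP[t _ ->]; apply: hrank.
have not_before x y : x != y -> ~~ edge x y -> ~~ all (before y x) ps.
  move=> hxy he; have [t ht] := hnedge _ _ hxy he.
  apply/allPn; exists (perm t); first by apply: map_f; rewrite mem_enum.
  rewrite -beforeN 1?eq_sym //; first exact: hrank.
  by rewrite mem_sort mem_enum.
exists (flatten ps); split=> [x _|] //; split=> [x|x y hxy].
  by rewrite -has_pred1 has_count hcount.
rewrite alternate_permutations //; split=> [/hedge[]/all_before -> //|].
  by rewrite orbT.
apply: contraTT => he; rewrite negb_or (not_before x y) //.
by rewrite (not_before y x) // 1?eq_sym // edge_sym.
Qed.

(** * The lower bound *)

Section Orders.
Variable ps : seq (seq G).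
Hypothesis perm_ps : forall p, p \in ps -> perm_eq p (enum G).
Hypothesis ps_represents : represents (flatten ps).

Definition precedes x y := all (before x y) ps.

Lemma precedes_trans y x z : precedes x y -> precedes y z -> precedes x z.
Proof.
move=> /allP hxy /allP hyz; apply/allP => p hp.
exact: before_trans (hxy p hp) (hyz p hp).
Qed.

Lemma edge_precedes x y : x != y -> edge x y = precedes x y || precedes y x.
Proof.
move=> hxy; rewrite -alternate_permutations //.
by apply/idP/idP => ?; apply/(proj2 ps_represents).
Qed.

Lemma edge_neq x y : edge x y -> x != y.
Proof. by apply: contraTneq => ->; rewrite edge_irrefl. Qed.

(** Otherwise [z] would precede [x], hence [y]: a missing edge. *)
Lemma forced_up x y z : precedes x y -> edge x z -> y != z -> ~~ edge z y ->
  precedes x z.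
Proof.
move=> hxy hxz hyz; have := hxz; rewrite edge_precedes ?edge_neq //.
case/orP=> // hzx; rewrite edge_precedes 1?eq_sym //.
by rewrite (precedes_trans hzx hxy).
Qed.

Lemma forced_down x y z : precedes x y -> edge z y -> x != z -> ~~ edge x z ->
  precedes z y.
Proof.
move=> hxy hzy hxz; have := hzy; rewrite edge_precedes ?edge_neq //.
case/orP=> // hyz; rewrite edge_precedes //.
by rewrite (precedes_trans hxy hyz).
Qed.

Lemma not_edge_reversed x y : x != y -> ~~ edge x y -> has (before y x) ps.
Proof.
move=> hxy; rewrite edge_precedes // negb_or => /andP[/allPn[p hp hn] _].
apply/hasP; exists p => //; rewrite beforeN //.
by rewrite (perm_mem (perm_ps hp)) mem_enum.
Qed.

(** One permutation reversing both [i] and [j] would contain the cycle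
    [b_i < a_i < b_j < a_j < b_i]. *)
Lemma reversals_bound k (a b : 'I_k -> G) :
  (forall i j, i != j -> precedes (a i) (b j)) ->
  (forall i, has (before (b i) (a i)) ps) -> k <= size ps.
Proof.
move=> hab hba; pose f i := find (before (b i) (a i)) ps.
have f_lt i : f i < size ps by rewrite -has_find.
have f_inj : injective f.
  move=> i j eij; apply/eqP; case: eqVneq => // hij; exfalso.
  have rev l : before (b l) (a l) (nth [::] ps (f l)) by apply: nth_find.
  have hi := rev i; have hj := rev j.
  have hp := mem_nth [::] (f_lt i).
  rewrite -eij in hj.
  have hij' := allP (hab _ _ hij) _ hp.
  have hji' : before (a j) (b i) (nth [::] ps (f i)).
    by apply: (allP (hab _ _ _) _ hp); rewrite eq_sym.
  have := before_trans (before_trans hi hij') (before_trans hj hji').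
  by rewrite /before ltnn.
have := @uniq_leq_size _ [seq f i | i <- enum 'I_k] (iota 0 (size ps)).
rewrite size_map size_enum_ord size_iota; apply.
  by rewrite map_inj_uniq // enum_uniq.
by move=> _ /mapP[i _ ->]; rewrite mem_iota f_lt.
Qed.

Definition induced_crown k (a b : 'I_k -> G) :=
  [/\ injective a, injective b, forall i j, edge (a i) (b j) = (i != j),
      forall i j, ~~ edge (a i) (a j) & forall i j, ~~ edge (b i) (b j)].

(** Off-diagonal pairs [(i, j)] stand for edges [a_i b_j]; the direction spreads
    along rows and columns.  A third index [l] gives the route
    [(i0, j0), (i0, l), (i, l), (i, j)], which avoids the diagonal. *)
Lemma crown_orientation k (a b : 'I_k -> G) (i0 j0 : 'I_k) : 2 < k ->
  induced_crown a b -> i0 != j0 -> precedes (a i0) (b j0) ->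
  forall i j, i != j -> precedes (a i) (b j).
Proof.
move=> hk [ainj binj hab ha hb] hij0 h0.
have up i j l : i != l -> precedes (a i) (b j) -> precedes (a i) (b l).
  move=> hil hij; have [<- //|hjl] := eqVneq j l.
  by apply: forced_up hij _ _ _; rewrite ?hab ?inj_eq.
have down i j l : l != j -> precedes (a i) (b j) -> precedes (a l) (b j).
  move=> hlj hij; have [<- //|hil] := eqVneq i l.
  by apply: forced_down hij _ _ _; rewrite ?hab ?inj_eq.
move=> i j hij.
have [l [hl0 hl]] : exists l : 'I_k, i0 != l /\ i != l.
  have : #|[set i0; i]| < #|[set: 'I_k]|.
    by rewrite cardsT card_ord; apply: leq_ltn_trans hk; rewrite cards2; case: eqP.
  rewrite ltnNge; case: (boolP ([set: 'I_k] \subset [set i0; i])).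
    by move/subset_leq_card->.
  case/subsetPn=> l _; rewrite !inE negb_or => /andP[h1 h2] _.
  by exists l; rewrite ![_ == l]eq_sym.
exact: up hij (down _ _ _ hl (up _ _ _ hl0 h0)).
Qed.

(** For [k = 2] two non-adjacent vertices already force two permutations.  For
    [k >= 3] the direction of the edge [a_0 b_1] decides which side of the
    crown is the lower one. *)
Lemma induced_crown_bound k (a b : 'I_k -> G) : 1 < k ->
  induced_crown a b -> k <= size ps.
Proof.
move=> hk hcrown; have [ainj binj hab ha hb] := hcrown.
pose i0 := Ordinal (ltnW hk); pose i1 := Ordinal hk.
have hi : i0 != i1 by [].
have [hk2|hk3] := leqP k 2.
  have ha01 : a i0 != a i1 by rewrite inj_eq.
  have ha10 : a i1 != a i0 by rewrite eq_sym.
  (* A single permutation cannot put [a i0] and [a i1] in both orders. *)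
  have /hasP[p hp hrev] := not_edge_reversed ha01 (ha i0 i1).
  have /hasP[q hq hrev'] := not_edge_reversed ha10 (ha i1 i0).
  apply: leq_trans hk2 _; case: (ps) hp hq => [|p' [|q' s]] //.
  rewrite !inE => /eqP ep /eqP eq; move: hrev hrev'; subst.
  by rewrite /before; lia.
have crown_swap : induced_crown b a.
  by split=> // i j; rewrite edge_sym hab eq_sym.
have hneq i : a i != b i.
  apply/eqP=> e; have [j hj] : exists j, i != j.
    by case: (eqVneq i i0) => [->|h]; [exists i1 | exists i0].
  by have := hb i j; rewrite -e hab hj.
have hnedge i : ~~ edge (a i) (b i) by rewrite hab eqxx.
have := hab i0 i1; rewrite hi edge_precedes; last first.
  by apply: edge_neq; rewrite hab.
case/orP => h.
  apply: (reversals_bound (crown_orientation hk3 hcrown hi h)) => i.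
  exact: not_edge_reversed.
apply: (reversals_bound (crown_orientation hk3 crown_swap _ h)) => // i.
by apply: not_edge_reversed; rewrite 1?eq_sym // edge_sym.
Qed.

End Orders.

End Representation.

(** * The crown with a universal vertex *)

Section UniversalCrown.
Variable k : nat.

(** Linearizing these ranks gives the usual realizer of the standard example:
    [a_t] is last on its side, [b_t] first on its own, and only [a_t], [b_t] are
    reversed across the sides. *)
Definition rank (t : 'I_k) (x : add_universal (crown k)) : nat :=
  match x with
  | None => 0
  | Some (inl i) => if i == t then 3 else 1
  | Some (inr j) => if j == t then 2 else 4
  end.

Lemma rank_edge (x y : add_universal (crown k)) : edge x y ->
  (forall t, rank t x < rank t y) \/ (forall t, rank t y < rank t x).
Proof.
case: x y => [[i|i]|] [[j|j]|] //=; rewrite /crown_rel /= => hij.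
- left=> t; case: (eqVneq i t) => [<-|]; last by case: ifP.
  by rewrite eq_sym (negbTE hij).
- by right=> t; case: ifP.
- right=> t; case: (eqVneq j t) => [<-|]; last by case: ifP.
  by rewrite (negbTE hij).
- by right=> t; case: ifP.
- by left=> t; case: ifP.
- by left=> t; case: ifP.
Qed.

Lemma rank_nonedge (x y : add_universal (crown k)) : 1 < k -> x != y ->
  ~~ edge x y -> exists t, rank t x < rank t y.
Proof.
move=> hk.
have other (i : 'I_k) : exists t, i != t.
  have [->|hi] := eqVneq i (Ordinal hk); last by exists (Ordinal hk).
  by exists (Ordinal (ltnW hk)).
case: x y => [[i|i]|] [[j|j]|] //=; rewrite /crown_rel /= => hij hedge.
- by exists j; rewrite eqxx; case: ifP hij => // /eqP->; rewrite eqxx.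
- have {hedge} <- : i = j by apply/eqP/negPn.
  by have [t ht] := other i; exists t; rewrite (negbTE ht).
- have {hedge} <- : i = j by apply/eqP/negPn.
  by exists i; rewrite eqxx.
- by exists i; rewrite eqxx; case: ifP hij => // /eqP->; rewrite eqxx.
Qed.

Lemma crown_induced : @induced_crown (add_universal (crown k)) k
  (fun i => Some (inl i)) (fun j => Some (inr j)).
Proof. by split=> // [i j []|i j []]. Qed.

End UniversalCrown.

Theorem theorem4 (k : nat) (hk : 2 <= k) :
  has_representation_number (add_universal (crown k)) k /\
  k = #|add_universal (crown k)| %/ 2.
Proof.
have hrep : uniformly_representable k (add_universal (crown k)).
  apply: (ranks_represent (r := @rank k)) => [|x y|x y]; first exact: ltnW.
    exact: rank_edge.
  exact: rank_nonedge.
split; last by rewrite card_option card_sum card_ord; lia.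
split=> // [|m [w [huniform hw]]]; first by case: hrep => w [_ ?]; exists w.
have huniv (x : add_universal (crown k)) :
    x != None -> @edge (add_universal (crown k)) None x.
  by case: x.
have [ps [<- hps hrepr]] :=
  @universal_permutations (add_universal (crown k)) None m w huniv huniform hw.
exact: (@induced_crown_bound _ ps hps hrepr k _ _ hk (crown_induced k)).
Qed.
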